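(* Let $\mathcal{H}$ be a separable complex Hilbert space, let $N \in B(\mathcal{H})$ be normal, let $U$ be a unitary operator belonging to $\mathcal{W}^*(N)$, let $a \in \mathbb{C}$ and $v \in \mathcal{H}$. Then the operator $T = N + a(Uv \otimes v)$ is a complex symmetric operator.
   Context: $\mathcal{W}^*(N)$ denotes the von Neumann algebra generated by $N$. For $x,y\in\mathcal{H}$, $x\otimes y$ denotes the rank-one operator $f \mapsto \langle f, y\rangle x$. A conjugation on $\mathcal{H}$ is a conjugate-linear map $C:\mathcal{H}\to\mathcal{H}$ that is isometric and involutive ($C^2=I$). An operator $T$ is complex symmetric if $T = CT^*C$ for some conjugation $C$. *)

(* Defs.v *)
(* complex numbers R[i] over an arbitrary realType R
   (mathcomp-real-closed's `complex`), Hilbert space axiomatized honestly. *)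
From HB Require Import structures.
From mathcomp Require Import all_boot all_order all_algebra.
From mathcomp Require Import complex.
From mathcomp Require Import reals.
Set Implicit Arguments. Unset Strict Implicit. Unset Printing Implicit Defensive.
Import Order.TTheory GRing.Theory Num.Theory.
Local Open Scope ring_scope.

Section Hilbert.
Variable R : realType.
Local Notation C := R[i].
Variable H : lmodType C.
Variable ip : H -> H -> C.   (* inner product, linear in the first slot *)

(* the induced norm ||x|| = sqrt <x,x> *)
Definition hnorm (x : H) : C := sqrtC (ip x x).

(* complex separable Hilbert space axioms *)
Definition is_sep_hilbert : Prop :=
  (forall (a : C) (x y z : H), ip (a *: x + y) z = a * ip x z + ip y z) /\
      (forall x y : H, ip y x = (ip x y)^*) /\
      (forall x : H, 0 <= ip x x) /\
      (forall x : H, ip x x = 0 -> x = 0) /\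
      (* completeness: every Cauchy sequence converges *)
      (forall u : nat -> H,
         (forall eps : C, 0 < eps -> exists N : nat, forall m n : nat,
             (N <= m)%N -> (N <= n)%N -> hnorm (u m - u n) < eps) ->
         exists l : H, forall eps : C, 0 < eps -> exists N : nat,
             forall n : nat, (N <= n)%N -> hnorm (u n - l) < eps) /\
      (* separability: a countable dense subset *)
      exists d : nat -> H, forall (x : H) (eps : C), 0 < eps ->
         exists n : nat, hnorm (x - d n) < eps.

(* bounded linear operators B(H) *)
Definition is_linear_op (T : H -> H) : Prop :=
  forall (a : C) (x y : H), T (a *: x + y) = a *: T x + T y.

Definition bounded_op (T : H -> H) : Prop :=
  is_linear_op T /\ exists M : C, forall x : H, hnorm (T x) <= M * hnorm x.

(* S is the (Hilbert space) adjoint of T *)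
Definition is_adjoint (T S : H -> H) : Prop :=
  forall x y : H, ip (T x) y = ip x (S y).

Definition normal_op (N : H -> H) : Prop :=
  bounded_op N /\
  exists Ns : H -> H, is_adjoint N Ns /\ forall x, N (Ns x) = Ns (N x).

Definition unitary_op (U : H -> H) : Prop :=
  bounded_op U /\
  exists Us : H -> H, is_adjoint U Us /\
    (forall x, U (Us x) = x) /\ (forall x, Us (U x) = x).

(* von Neumann algebra: a unital *-subalgebra of B(H) closed in the weak
   operator topology *)
Definition wot_closed (A : (H -> H) -> Prop) : Prop :=
  forall T : H -> H, bounded_op T ->
    (forall (s : seq (H * H)) (eps : C), 0 < eps ->
       exists S : H -> H, A S /\
         (forall p, p \in s -> `| ip (T p.1 - S p.1) p.2 | < eps)) ->
    A T.

Definition is_vN_algebra (A : (H -> H) -> Prop) : Prop :=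
  (forall T, A T -> bounded_op T) /\
  A id /\
  (forall S T, A S -> A T -> A (fun x => S x + T x)) /\
  (forall (a : C) T, A T -> A (fun x => a *: T x)) /\
  (forall S T, A S -> A T -> A (fun x => S (T x))) /\
  (forall T Ts, A T -> is_adjoint T Ts -> A Ts) /\
  wot_closed A.

(* W*(N): the von Neumann algebra generated by N *)
Definition in_Wstar (N U : H -> H) : Prop :=
  forall A : (H -> H) -> Prop, is_vN_algebra A -> A N -> A U.

(* rank-one operator x (x) y : f |-> <f, y> x *)
Definition rank_one (x y : H) : H -> H := fun f => ip f y *: x.

(* conjugation: conjugate-linear, isometric, involutive *)
Definition conjugation (Cj : H -> H) : Prop :=
  [/\ (forall (a : C) (x y : H), Cj (a *: x + y) = a^* *: Cj x + Cj y),
      (forall x : H, hnorm (Cj x) = hnorm x)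
    & (forall x : H, Cj (Cj x) = x)].

(* T is complex symmetric: T = C T^* C for some conjugation C *)
Definition complex_symmetric (T : H -> H) : Prop :=
  exists Ts : H -> H, is_adjoint T Ts /\
  exists Cj : H -> H, conjugation Cj /\ forall x : H, T x = Cj (Ts (Cj x)).

End Hilbert.

(* Main.v *)
(* It suffices to find a conjugation J with J N J = N^*, J v = v and
   J U J = U^*: then C = U J is a conjugation intertwining N and N^* with
   C v = U v. Such a J is determined by its fixed vectors, a real form of H, and
   a real form with the right properties exists for abstract reasons. Call x, y
   related when <T x, y> is real for all self-adjoint T in the bicommutant of
   {N, N^*}. A maximal family F of pairwise related vectors containing v is a
   closed real subspace, invariant under these (commuting) T; and a vector w
   orthogonal to F is related to all of F, hence lies in F, hence is 0. By the
   real projection theorem H = F + iF, and J (x + i y) = x - i y commutes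
   with every self-adjoint T of the bicommutant, so J T J = T^* for
   every adjointable T in it. As the bicommutant is a von Neumann algebra
   containing N, it contains U. *)
Require Import Defs.
From HB Require Import structures.
From mathcomp Require Import all_boot all_order all_algebra.
From mathcomp Require Import complex.
From mathcomp Require Import reals.
From mathcomp Require Import boolp classical_sets.
From mathcomp Require Import ring lra.
Import Order.TTheory GRing.Theory Num.Theory.
Local Open Scope ring_scope.

(** * Arithmetic of [R[i]] *)

Section ComplexNumbers.
Variable R : realType.

Lemma realC_sqr (r : R) : r%:C%C ^+ 2 = (r ^+ 2)%:C%C :> R[i].
Proof. by rewrite rmorphXn. Qed.

Lemma Re_realM (r : R) (c : R[i]) : complex.Re (r%:C%C * c) = r * complex.Re c.
Proof. by case: c => a b /=; rewrite mul0r subr0. Qed.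

Lemma Re_conj (c : R[i]) : complex.Re c^* = complex.Re c.
Proof. by case: c. Qed.

Lemma conj_real (r : R) : (r%:C%C)^* = r%:C%C :> R[i].
Proof. by apply/eqP; rewrite eq_complex /= oppr0 !eqxx. Qed.

Lemma conj_i : 'i%C^* = - 'i%C :> R[i].
Proof. by apply/eqP; rewrite eq_complex /= oppr0 !eqxx. Qed.

Lemma mul_ii : 'i%C * 'i%C = - 1 :> R[i].
Proof. by rewrite -expr2 sqr_i. Qed.

End ComplexNumbers.

(** * Inner product, norm and the Cauchy-Schwarz inequality *)

Section SeparableHilbert.
Variables (R : realType) (H : lmodType R[i]) (ip : H -> H -> R[i]).
Hypothesis hH : is_sep_hilbert ip.
Implicit Types (x y z : H) (T S : H -> H).

Let ip_lin a x y z : ip (a *: x + y) z = a * ip x z + ip y z.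
Proof. by case: hH. Qed.

Lemma ip_conj x y : (ip x y)^* = ip y x.
Proof. by case: hH => _ [h _]; rewrite -h. Qed.

Lemma ip_ge0 x : 0 <= ip x x.
Proof. by case: hH => _ [_ []]. Qed.

Lemma ip_eq0 x : ip x x = 0 -> x = 0.
Proof. by case: hH => _ [_ [_ [h _]]]; apply: h. Qed.

Lemma ipDl x y z : ip (x + y) z = ip x z + ip y z.
Proof. by rewrite -{1}(scale1r x) ip_lin mul1r. Qed.

Lemma ip0l z : ip 0 z = 0.
Proof. by apply: (addrI (ip 0 z)); rewrite -ipDl !addr0. Qed.

Lemma ipZl a x z : ip (a *: x) z = a * ip x z.
Proof. by rewrite -(addr0 (a *: x)) ip_lin ip0l addr0. Qed.

Lemma ipNl x z : ip (- x) z = - ip x z.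
Proof. by rewrite -scaleN1r ipZl mulN1r. Qed.

Lemma ipDr x y z : ip x (y + z) = ip x y + ip x z.
Proof. by rewrite -ip_conj ipDl rmorphD /= !ip_conj. Qed.

Lemma ipZr a x y : ip x (a *: y) = a^* * ip x y.
Proof. by rewrite -ip_conj ipZl rmorphM /= ip_conj. Qed.

Lemma ipNr x y : ip x (- y) = - ip x y.
Proof. by rewrite -ip_conj ipNl rmorphN /= ip_conj. Qed.

Lemma ip0r x : ip x 0 = 0.
Proof. by rewrite -ip_conj ip0l rmorph0. Qed.

Definition ipE := (ipDl, ipDr, ipNl, ipNr, ipZl, ipZr, ip0l, ip0r).

Lemma ip_injl x y : (forall z, ip x z = ip y z) -> x = y.
Proof.
move=> h; apply/subr0_eq/ip_eq0.
by rewrite ipDl ipNl h subrr.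
Qed.

(** For [ip y y != 0] the gap between the two sides is [ip y y] times the squared norm of the
    component of [x] orthogonal to [y]. *)
Lemma ip_cauchy_schwarz x y : `|ip x y| ^+ 2 <= ip x x * ip y y.
Proof.
have [y0|y0] := eqVneq (ip y y) 0.
  by rewrite (ip_eq0 _ y0) !ip0r normr0 expr0n mulr0.
have yp : 0 < ip y y by rewrite lt_def y0 ip_ge0.
rewrite -subr_ge0.
suff -> : ip x x * ip y y - `|ip x y| ^+ 2 =
    ip y y * ip (x - (ip x y / ip y y) *: y) (x - (ip x y / ip y y) *: y).
  by rewrite mulr_ge0 ?ip_ge0.
rewrite normCK !ipE rmorphM /= fmorphV /= !ip_conj.
by field.
Qed.

Lemma hnorm_ge0 x : 0 <= hnorm ip x.
Proof. by rewrite sqrtC_ge0 ip_ge0. Qed.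

Lemma hnormK x : hnorm ip x ^+ 2 = ip x x.
Proof. exact: sqrtCK. Qed.

Lemma norm_ip_le x y : `|ip x y| <= hnorm ip x * hnorm ip y.
Proof.
rewrite -(@ler_pXn2r _ 2) ?nnegrE ?mulr_ge0 ?hnorm_ge0 //.
by rewrite exprMn !hnormK ip_cauchy_schwarz.
Qed.

Lemma hnormD x y : hnorm ip (x + y) <= hnorm ip x + hnorm ip y.
Proof.
rewrite -(@ler_pXn2r _ 2) ?nnegrE ?addr_ge0 ?hnorm_ge0 //.
rewrite hnormK -[leLHS]ger0_norm ?ip_ge0 // ipDl !ipDr.
apply: (le_trans (ler_normD _ _)).
apply: (le_trans (lerD (ler_normD _ _) (ler_normD _ _))).
rewrite !(ger0_norm (ip_ge0 _)) -!hnormK.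
have h1 := norm_ip_le x y; have h2 := norm_ip_le y x.
rewrite (_ : (_ + _) ^+ 2 = (hnorm ip x ^+ 2 + hnorm ip x * hnorm ip y)
  + (hnorm ip y * hnorm ip x + hnorm ip y ^+ 2)); last by ring.
by rewrite lerD // lerD.
Qed.

Lemma hnormZ a x : hnorm ip (a *: x) = `|a| * hnorm ip x.
Proof.
apply/eqP; rewrite -(@eqrXn2 _ 2) ?mulr_ge0 ?hnorm_ge0 //.
by rewrite exprMn !hnormK normCK !ipE mulrA.
Qed.

(** * The underlying real inner product and projection onto closed real subspaces *)

Let q x := complex.Re (ip x x).
Let b x y := complex.Re (ip x y).

Let bC x y : b x y = b y x.
Proof. by rewrite /b -(ip_conj x y) Re_conj. Qed.

Let bD x y z : b (x + y) z = b x z + b y z.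
Proof. by rewrite /b ipDl raddfD. Qed.

Let bN x z : b (- x) z = - b x z.
Proof. by rewrite /b ipNl raddfN. Qed.

Let bZ r x z : b (r%:C%C *: x) z = r * b x z.
Proof. by rewrite /b ipZl Re_realM. Qed.

Let qD x y : q (x + y) = q x + 2 * b x y + q y.
Proof.
rewrite -[q _]/(b _ _) bD 2!(bC _ (x + y)) !bD (bC y x) -[q x]/(b x x) -[q y]/(b y y).
by ring.
Qed.

Let qN x : q (- x) = q x.
Proof. by rewrite -[q _]/(b _ _) bN bC bN opprK. Qed.

Let qZ r x : q (r%:C%C *: x) = r ^+ 2 * q x.
Proof. by rewrite -[q _]/(b _ _) bZ bC bZ mulrA. Qed.

Let ip_q x : ip x x = (q x)%:C%C.
Proof.
have := ip_ge0 x; rewrite lecE /= => /andP[/eqP h _].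
by rewrite /q; case: (ip x x) h => r i /= ->.
Qed.

Let q_ge0 x : 0 <= q x.
Proof. by have := ip_ge0 x; rewrite ip_q lecR. Qed.

Let b_cauchy_schwarz x y : b x y ^+ 2 <= q x * q y.
Proof.
rewrite -lecR (_ : (q x * q y)%:C%C = ip x x * ip y y); last by rewrite !ip_q rmorphM.
apply: le_trans (ip_cauchy_schwarz x y).
rewrite -real_normK ?num_real // -realC_sqr ler_pXn2r ?nnegrE ?normr_ge0 ?normc_ge_Re //.
by rewrite lecR.
Qed.

Let hnorm_lt_q x (e : R) : 0 < e -> (hnorm ip x < e%:C%C) = (q x < e ^+ 2).
Proof.
move=> e0; rewrite -(@ltr_pXn2r _ 2) ?nnegrE ?hnorm_ge0 ?lecR ?(ltW e0) //.
by rewrite hnormK ip_q -ltcR -realC_sqr.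
Qed.

Let small_inv (e : R) : 0 < e -> exists M, forall n, (M <= n)%N -> n.+1%:R^-1 < e.
Proof.
move=> e0; exists (Num.bound e^-1) => n Mn.
rewrite invf_plt ?posrE // (lt_le_trans (archi_boundP _)) ?invr_ge0 ?(ltW e0) //.
by rewrite ler_nat leqW.
Qed.

Definition tends (u : nat -> H) (l : H) : Prop :=
  forall eps : R[i], 0 < eps -> exists M : nat,
    forall n : nat, (M <= n)%N -> hnorm ip (u n - l) < eps.

Let posC (eps : R[i]) : 0 < eps -> eps = (complex.Re eps)%:C%C /\ 0 < complex.Re eps.
Proof. by case: eps => r i; rewrite ltcE /= => /andP[/eqP -> ->]. Qed.

(** A minimizing sequence for the distance from [h] to [F] is Cauchy by the parallelogram identity,
    and its limit is the projection. As [F] is only a real subspace, orthogonality holds for the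
    real part of [ip]. *)
Lemma real_projection (F : set H) (h : H) : F 0 ->
  (forall x y, F x -> F y -> F (x + y)) ->
  (forall (r : R) x, F x -> F (r%:C%C *: x)) ->
  (forall u l, (forall n, F (u n)) -> tends u l -> F l) ->
  exists2 x, F x & forall f, F f -> complex.Re (ip (h - x) f) = 0.
Proof.
move=> F0 FD FZ Fcl.
pose E : set R := [set q (h - f) | f in F]%classic.
have Einf : has_inf E.
  split; first by exists (q (h - 0)), 0.
  by exists 0 => _ [f _ <-]; exact: q_ge0.
have Elb f : F f -> inf E <= q (h - f).
  by move=> Ff; apply: ge_inf; [case: Einf | exists f].
have /choice[u uP] n : exists f, F f /\ q (h - f) < inf E + n.+1%:R^-1.
  have /(inf_adherent)/(_ Einf)[_ [f Ff <-] hf] : 0 < n.+1%:R^-1 :> R by rewrite invr_gt0.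
  by exists f.
have uF n : F (u n) by case: (uP n).
have uq n : q (h - u n) < inf E + n.+1%:R^-1 by case: (uP n).
have ucauchy m n : q (u m - u n) <= 2 * m.+1%:R^-1 + 2 * n.+1%:R^-1.
  (* The midpoint of [u m] and [u n] lies in [F], so its squared distance to [h] is at least
     [inf E]; the parallelogram identity then bounds [q (u m - u n)]. *)
  have hmid : F ((2^-1)%:C%C *: (u m + u n)) by apply/FZ/FD.
  have := Elb _ hmid; have := uq m; have := uq n.
  set y := h - _ *: _; set xm := h - u m; set xn := h - u n => hn hm hy.
  have -> : u m - u n = xn - xm by rewrite /xn /xm opprB [RHS]addrC addrA subrK.
  have hyq : 4 * q y = q (xm + xn).
    have -> : xm + xn = 2%:C%C *: y.
      have h2 : 2%:C%C = 2%:R :> R[i] by rewrite (rmorph_nat (real_complex R)).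
      have h1 : 2%:C%C * (2^-1)%:C%C = 1 :> R[i].
        apply/eqP; rewrite eq_complex /=.
        by rewrite ?(mul0r, mulr0, subr0, addr0, divff, eqxx, pnatr_eq0) ?andbT ?pnatr_eq0.
      by rewrite /y scalerBr scalerA h1 scale1r h2 scaler_nat mulr2n opprD addrACA.
    by rewrite qZ; congr (_ * _); ring.
  have := qD xm xn; have := qD xn (- xm).
  rewrite qN (bC xn) bN; move: hn hm hy hyq; move: (inf E) m.+1%:R^-1 n.+1%:R^-1.
  by move: (q xn) (q xm) (q y) (q (xm + xn)) (q (xn - xm)) (b xm xn) => *; lra.
have [l ul] : exists l, tends u l.
  case: hH => _ [_ [_ [_ [hc _]]]]; apply: hc => eps /posC[->]; move: (complex.Re eps) => e e0.
  have [|M hM] := small_inv (e ^+ 2 / 4); first by rewrite divr_gt0 ?exprn_gt0.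
  exists M => m n /hM hm /hM hn; rewrite hnorm_lt_q //.
  apply: le_lt_trans (ucauchy m n) _.
  by move: hm hn; move: m.+1%:R^-1 n.+1%:R^-1 (e ^+ 2) => *; lra.
exists l; first exact: Fcl ul.
move=> f Ff; rewrite -/(b (h - l) f).
(* Moving [u n] along [f] by the optimal amount [b (h - u n) f / q f] stays in [F] and lowers the
   squared distance by [b (h - u n) f ^+ 2 / q f], which cannot exceed the excess of [u n] over
   [inf E]. *)
have hun n : b (h - u n) f ^+ 2 <= q f * n.+1%:R^-1.
  have [qf0|qf0] := eqVneq (q f) 0.
    by rewrite qf0 mul0r; have := b_cauchy_schwarz (h - u n) f; rewrite qf0 mulr0.
  have qfp : 0 < q f by rewrite lt_def qf0 q_ge0.
  have := Elb (u n + (b (h - u n) f / q f)%:C%C *: f) (FD _ _ (uF n) (FZ _ _ Ff)).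
  rewrite opprD addrA qD qN qZ bC bN bZ (bC f) => hlb; have := uq n => hu.
  rewrite -ler_pdivrMl // mulrC.
  have : b (h - u n) f ^+ 2 / q f = - (2 * - (b (h - u n) f / q f * b (h - u n) f)
     + (b (h - u n) f / q f) ^+ 2 * q f) by field.
  move=> ->; move: hlb hu; move: (inf E) (q _) n.+1%:R^-1 (2 * _) (_ * q f) => *; lra.
(* Split [h - l] at [u n]: each of the two terms has square at most [q f * e], and the square of a
   sum is at most twice the sum of the squares. *)
have hle e : 0 < e -> b (h - l) f ^+ 2 <= 4 * q f * e.
  move=> e0; have [M1 hM1] := small_inv _ e0.
  have [|M2 hM2] := ul (Num.sqrt e)%:C%C; first by rewrite ltcR sqrtr_gt0.
  pose n := maxn M1 M2.
  have := hM2 n (leq_maxr _ _); rewrite hnorm_lt_q ?sqrtr_gt0 // sqr_sqrtr ?(ltW e0) // => h2.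
  have h1 := hM1 n (leq_maxl _ _).
  have -> : h - l = (h - u n) + (u n - l) by rewrite addrA subrK.
  rewrite bD.
  have h3 := hun n; have h4 := b_cauchy_schwarz (u n - l) f.
  have h5 : q f * n.+1%:R^-1 <= q f * e by rewrite ler_wpM2l ?q_ge0 // ltW.
  have h6 : q (u n - l) * q f <= q f * e by rewrite mulrC ler_wpM2l ?q_ge0 // ltW.
  have h7 := sqr_ge0 (b (h - u n) f - b (u n - l) f).
  move: (le_trans h3 h5) (le_trans h4 h6) h7; rewrite -mulrA.
  by move: (b (h - u n) f) (b (u n - l) f) (q f * e) => *; nra.
apply/eqP; rewrite -sqrf_eq0; apply/negPn/negP => hb.
have Bp : 0 < b (h - l) f ^+ 2 by rewrite lt_def hb sqr_ge0.
have Qp : 0 < 4 * q f + 1 by have := q_ge0 f; lra.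
(* This choice of [e] makes the bound strictly smaller than the left side; the [+ 1] keeps the
   denominator positive when [q f] vanishes. *)
have := hle (b (h - l) f ^+ 2 / (4 * q f + 1)); rewrite divr_gt0 // => /(_ isT).
rewrite mulrA ler_pdivlMr //.
by move: Bp; move: (b _ f ^+ 2) => *; nra.
Qed.

(** * Adjoints and bounded operators *)

Lemma adjoint_sym T S : is_adjoint ip T S -> is_adjoint ip S T.
Proof. by move=> h x y; rewrite -ip_conj -h ip_conj. Qed.

Lemma adjoint_linear T S : is_adjoint ip T S -> is_linear_op T.
Proof. by move=> h a x y; apply: ip_injl => z; rewrite !(ipE, h). Qed.

Lemma linear_opD T x y : is_linear_op T -> T (x + y) = T x + T y.
Proof. by move=> h; rewrite -{1}(scale1r x) h scale1r. Qed.

Lemma linear_op0 T : is_linear_op T -> T 0 = 0.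
Proof. by move=> h; apply: (addrI (T 0)); rewrite -linear_opD // !addr0. Qed.

Lemma linear_opZ T a x : is_linear_op T -> T (a *: x) = a *: T x.
Proof. by move=> h; rewrite -[a *: x]addr0 h linear_op0 // addr0. Qed.

(** The constant in [bounded_op] is any complex number; its modulus also works, since
    [M * hnorm ip x] dominates a norm and so equals its own modulus. *)
Lemma bounded_op_ge0 T : bounded_op ip T ->
  exists2 M, 0 <= M & forall x, hnorm ip (T x) <= M * hnorm ip x.
Proof.
move=> [_ [M hM]]; exists `|M| => // x.
rewrite -[hnorm ip x]ger0_norm ?hnorm_ge0 // -normrM.
rewrite -[hnorm ip (T x)]ger0_norm ?hnorm_ge0 //.
have hx := le_trans (hnorm_ge0 _) (hM x).
by rewrite !ger0_norm ?hnorm_ge0 // hM.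
Qed.

(** The squared norm of [S y] is [ip (T (S y)) y], hence at most [M] times the norms of [S y] and
    [y]; one then divides by the norm of [S y]. *)
Lemma bounded_op_adjoint T S : bounded_op ip T -> is_adjoint ip T S -> bounded_op ip S.
Proof.
move=> Tb TS; split; first exact/adjoint_linear/adjoint_sym/TS.
have [M M0 hM] := bounded_op_ge0 _ Tb; exists M => y.
have [->|y0] := eqVneq (hnorm ip (S y)) 0; first by rewrite mulr_ge0 ?hnorm_ge0.
have yp : 0 < hnorm ip (S y) by rewrite lt_def y0 hnorm_ge0.
rewrite -(ler_pM2l yp) -expr2 hnormK -TS -[leLHS]ger0_norm; last first.
  by rewrite TS ip_ge0.
apply: le_trans (norm_ip_le _ _) _.
by rewrite mulrA [_ * M]mulrC ler_wpM2r ?hnorm_ge0.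
Qed.

(** * The bicommutant of [N] and its adjoint as a von Neumann algebra *)

Section Bicommutant.
Variables (N Ns : H -> H).
Hypotheses (NNs : is_adjoint ip N Ns) (NC : forall x, N (Ns x) = Ns (N x)).

(** Boundedness is encoded by the existence of an adjoint, which also yields linearity. *)
Definition commutant S : Prop := exists Ss, is_adjoint ip S Ss /\
  (forall x, S (N x) = N (S x)) /\ (forall x, S (Ns x) = Ns (S x)).

Definition bicommutant T : Prop :=
  forall S, commutant S -> forall x, T (S x) = S (T x).

(** Taking adjoints exchanges the two commutation relations, which is why [commutant] asks for both
    [N] and [Ns]. *)
Lemma commutant_adjoint S Ss : is_adjoint ip S Ss -> commutant S -> commutant Ss.
Proof.
move=> SSs [_ [_ [SN SNs]]]; exists S; have sSS := adjoint_sym _ _ SSs.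
have NsN := adjoint_sym _ _ NNs.
split=> //; split=> x; apply: ip_injl => z.
  by rewrite sSS NNs -SNs NNs sSS.
by rewrite sSS NsN -SN NsN sSS.
Qed.

Lemma bicommutant_adjoint T Ts :
  is_adjoint ip T Ts -> bicommutant T -> bicommutant Ts.
Proof.
move=> TTs hT S Sc x; have [Ss [SSs _]] := Sc.
apply: ip_injl => z; have sTT := adjoint_sym _ _ TTs.
by rewrite sTT SSs SSs sTT (hT _ (commutant_adjoint _ _ SSs Sc)).
Qed.

Lemma bicommutant_vN :
  is_vN_algebra ip (fun T => bounded_op ip T /\ bicommutant T).
Proof.
have cl S : commutant S -> is_linear_op S by case=> Ss [/adjoint_linear].
split; first by move=> T [].
split.
  by split=> //; split=> //; exists 1 => x; rewrite mul1r.
split.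
  move=> S T [Sb Sc] [Tb Tc]; split; last first.
    by move=> Q Qc x; rewrite Sc // Tc // linear_opD //; exact: cl.
  split; first by move=> a x y; rewrite Sb.1 Tb.1 scalerDr addrACA.
  have [M1 _ h1] := bounded_op_ge0 _ Sb; have [M2 _ h2] := bounded_op_ge0 _ Tb.
  exists (M1 + M2) => x; apply: le_trans (hnormD _ _) _.
  by rewrite mulrDl lerD.
split.
  move=> a T [Tb Tc]; split; last first.
    by move=> Q Qc x; rewrite Tc // linear_opZ //; exact: cl.
  split; first by move=> c x y; rewrite Tb.1 scalerDr !scalerA mulrC.
  have [M _ h] := bounded_op_ge0 _ Tb.
  by exists (`|a| * M) => x; rewrite hnormZ -mulrA ler_wpM2l.
split.
  move=> S T [Sb Sc] [Tb Tc]; split; last first.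
    by move=> Q Qc x; rewrite Tc // Sc.
  split; first by move=> a x y; rewrite Tb.1 Sb.1.
  have [M1 p1 h1] := bounded_op_ge0 _ Sb; have [M2 _ h2] := bounded_op_ge0 _ Tb.
  exists (M1 * M2) => x; apply: le_trans (h1 _) _.
  by rewrite -mulrA ler_wpM2l.
split.
  move=> T Ts [Tb Tc] TTs; split; first exact: bounded_op_adjoint TTs.
  exact: bicommutant_adjoint TTs Tc.
move=> T Tb Tapp; split=> // S Sc x; have [Ss [SSs _]] := Sc.
apply: ip_injl => z; apply/eqP; rewrite -subr_eq0; apply/negPn/negP => D0.
set D := _ - _ in D0; have Dp : 0 < `|D| / 2 by rewrite divr_gt0 ?normr_gt0.
(* Since [Q] commutes with [S], the defect [D] is the difference of the errors of [Q] at these two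
   test pairs, each below half of [D] in modulus. *)
have [Q [[_ Qc] hQ]] := Tapp [:: (S x, z); (x, Ss z)] _ Dp.
have /hQ/= h1 : (S x, z) \in [:: (S x, z); (x, Ss z)] by rewrite inE eqxx.
have /hQ/= h2 : (x, Ss z) \in [:: (S x, z); (x, Ss z)] by rewrite !inE eqxx orbT.
have : `|D| < `|D|.
  have {1}-> : D = ip (T (S x) - Q (S x)) z - ip (T x - Q x) (Ss z).
    by rewrite Qc // !ipE -!SSs /D; ring.
  apply: le_lt_trans (ler_normB _ _) _.
  by rewrite [ltRHS]splitr ltrD.
by rewrite ltxx.
Qed.

(** * Self-adjoint elements of the bicommutant and maximal related families *)

Definition sa_bicommutant T : Prop := is_adjoint ip T T /\ bicommutant T.

(** Normality puts [N] and [Ns] in the commutant, so [T] commutes with both. Being its own adjoint,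
    [T] is then itself in the commutant, and [S] commutes with it. *)
Lemma sa_bicommutant_comm S T :
  sa_bicommutant S -> sa_bicommutant T -> forall x, S (T x) = T (S x).
Proof.
move=> [_ Sc] [TT Tc]; apply: Sc; exists T; split=> //.
have Nc : commutant N by exists Ns.
by split; apply: Tc; [|apply: commutant_adjoint Nc].
Qed.

Lemma sa_bicommutant_comp S T :
  sa_bicommutant S -> sa_bicommutant T -> sa_bicommutant (fun x => S (T x)).
Proof.
move=> hS hT; split=> [x y|Q Qc x]; last by rewrite hT.2 // hS.2.
by rewrite hS.1 hT.1 (sa_bicommutant_comm _ _ hS hT).
Qed.

Lemma sa_bicommutant_id : sa_bicommutant id.
Proof. by []. Qed.

(* [ip (T y) x] is the conjugate of [ip (T x) y], as [T] is self-adjoint; so this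
   says that [ip (T x) y] is real. *)
Definition real_related x y : Prop :=
  forall T, sa_bicommutant T -> ip (T x) y = ip (T y) x.

(** Zorn's lemma gives a maximal family. Every vector is related to itself, so a vector related to
    the whole family could be added and hence already belongs to it. *)
Lemma real_form_exists v : exists F : set H,
  [/\ F v, forall x y, F x -> F y -> real_related x y
    & forall z, (forall x, F x -> real_related z x) -> F z].
Proof.
have rs x y : real_related x y -> real_related y x by move=> h T hT; rewrite h.
(* Building [v] into the condition covers the empty chain and forces [v] into a maximal [A]. *)
pose P (A : set H) := forall x y, (A x \/ x = v) -> (A y \/ y = v) -> real_related x y.
have [A PA Amax] : exists2 A, P A & forall B, (A `<` B)%classic -> ~ P B.
  have [|A [PA Amax]] := @Zorn_bigcup H P; last by exists A.
  move=> C CP Ctot x y [[X CX Xx]|->] [[Y CY Yy]|->].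
  - have [h|h] := Ctot _ _ CX CY.
      by apply: (CP _ CY); left => //; apply: h.
    by apply: (CP _ CX); left => //; apply: h.
  - by apply: (CP _ CX); [left|right].
  - by apply: (CP _ CY); [right|left].
  - by [].
have Fadd z : (forall x, A x -> real_related z x) -> real_related z v -> A z.
  move=> hz hzv; apply: contrapT => nAz; apply: (Amax (A `|` [set z])%classic).
    by split=> [x Ax|h]; [left|apply: nAz; apply: h; right].
  have hzx x : A x \/ x = v -> real_related z x by move=> [/hz|->].
  move=> x y [[Ax|->]|->] [[Ay|->]|->]; by [ | apply: hzx; auto | apply/rs/hzx; auto
     | apply: PA; auto].
have Av : A v by apply: Fadd => // x Ax; apply: PA; auto.
exists A; split=> // [x y Ax Ay|z hz]; first by apply: PA; left.
by apply: Fadd; [|apply: hz].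
Qed.

Lemma ip_tends_le u l y : tends u l ->
  forall e : R[i], 0 < e -> exists n, `|ip (u n - l) y| < e.
Proof.
move=> ul e e0; have y1 : 0 < hnorm ip y + 1 by rewrite ltr_wpDl ?hnorm_ge0.
(* Adding 1 avoids a division by zero when [y = 0]. *)
have [|M hM] := ul (e / (hnorm ip y + 1)); first by rewrite divr_gt0.
exists M; apply: le_lt_trans (norm_ip_le _ _) _.
apply: le_lt_trans (_ : hnorm ip (u M - l) * (hnorm ip y + 1) < _).
  by rewrite ler_wpM2l ?hnorm_ge0 // lerDl.
by rewrite -ltr_pdivlMr ?hM.
Qed.

(** * A maximal related family [F] is a real form of [H] *)

Section RealForm.
Variable F : set H.
Hypotheses (Frel : forall x y, F x -> F y -> real_related x y)
  (Fmax : forall z, (forall x, F x -> real_related z x) -> F z).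

Lemma real_formD x y : F x -> F y -> F (x + y).
Proof.
move=> Fx Fy; apply: Fmax => z Fz T hT.
by rewrite (linear_opD _ _ _ (adjoint_linear _ _ hT.1)) !ipE !(Frel _ z).
Qed.

Lemma real_formZ (r : R) x : F x -> F (r%:C%C *: x).
Proof.
move=> Fx; apply: Fmax => z Fz T hT.
by rewrite (linear_opZ _ _ _ (adjoint_linear _ _ hT.1)) !ipE conj_real (Frel x z).
Qed.

Lemma real_form0 : F 0.
Proof.
apply: Fmax => z Fz T hT.
by rewrite (linear_op0 _ (adjoint_linear _ _ hT.1)) !ipE.
Qed.

Lemma real_formN x : F x -> F (- x).
Proof.
move=> Fx; apply: Fmax => z Fz T hT.
rewrite -scaleN1r (linear_opZ _ _ _ (adjoint_linear _ _ hT.1)).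
by rewrite scaleN1r !ipE (Frel x z) // mulN1r.
Qed.

(** Testing [T x] against [S] amounts to testing [x] against the composite of [S] and [T], which is
    self-adjoint because they commute. *)
Lemma real_form_invariant T x : sa_bicommutant T -> F x -> F (T x).
Proof.
move=> hT Fx; apply: Fmax => z Fz S hS.
have := Frel _ _ Fx Fz _ (sa_bicommutant_comp _ _ hS hT) => ->.
by rewrite (sa_bicommutant_comm _ _ hS hT) hT.1.
Qed.

Lemma real_form_closed u l : (forall n, F (u n)) -> tends u l -> F l.
Proof.
move=> Fu ul; apply: Fmax => z Fz T hT; apply/eqP; rewrite -subr_eq0.
apply/negPn/negP => D0; set D := _ - _ in D0.
have Dp : 0 < `|D| / 2 by rewrite divr_gt0 ?normr_gt0.
have [n hn] := ip_tends_le u l (T z) ul _ Dp.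
have : `|D| < `|D|.
  (* The analogue of [D] for [u n] vanishes, so only the error [u n - l] contributes, once
     conjugated and once not. *)
  have {1}-> : D = (ip (u n - l) (T z))^* - ip (u n - l) (T z).
    rewrite ip_conj !ipE -!hT.1 (Frel (u n) z) // /D (hT.1 z (u n)).
    by rewrite (hT.1 z l) -!hT.1; ring.
  apply: le_lt_trans (ler_normB _ _) _.
  by rewrite norm_conjC [ltRHS]splitr ltrD.
by rewrite ltxx.
Qed.

(** By invariance [ip (T w) z = ip w (T z) = 0] for [z] in [F]. So [w] is related to all of [F],
    lies in [F], and is orthogonal to itself. *)
Lemma real_form_orth w : (forall f, F f -> ip w f = 0) -> w = 0.
Proof.
move=> hw; suff Fw : F w by apply/ip_eq0/hw.
apply: Fmax => z Fz T hT.
by rewrite hT.1 -(ip_conj w) !hw ?conjC0 //; apply: real_form_invariant.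
Qed.

Lemma real_form_ip x y : F x -> F y -> ip x y = ip y x.
Proof. by move=> Fx Fy; apply: (Frel _ _ Fx Fy _ sa_bicommutant_id). Qed.

(** Take for [x] and [y] the real projections of [h] and [- 'i *: h]. As [ip] is real on [F], both
    the real and the imaginary part of the inner product of [h - (x + 'i *: y)] with any [f] in [F]
    vanish. *)
Lemma real_form_decomp h : exists p : H * H,
  [/\ F p.1, F p.2 & h = p.1 + 'i%C *: p.2].
Proof.
have proj := real_projection F _ real_form0 real_formD real_formZ real_form_closed.
have [x Fx hx] := proj h; have [y Fy hy] := proj (- 'i%C *: h).
exists (x, y); split=> //=; apply/subr0_eq/real_form_orth => f Ff.
have /(congr1 (@complex.Re R)) h1 : ip (h - (x + 'i%C *: y)) f =
   ip (h - x) f - 'i%C * ip y f by rewrite !ipE; ring.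
have /(congr1 (@complex.Re R)) h2 : - 'i%C * ip (h - (x + 'i%C *: y)) f =
   ip (- 'i%C *: h - y) f + 'i%C * ip x f.
  rewrite !ipE; transitivity (- 'i%C * ip h f + 'i%C * ip x f + 'i%C * 'i%C * ip y f).
    by ring.
  by rewrite mul_ii; ring.
have real0 z : F z -> complex.Im (ip z f) = 0.
  move=> Fz; have := ip_conj z f; rewrite (real_form_ip f z) //.
  by case: (ip z f) => a c [] /eqP; rewrite eqNr => /eqP.
move: h1 h2; rewrite !raddfD !raddfN /= hx // hy //.
move: (real0 x Fx) (real0 y Fy).
case: (ip x f) => a1 c1; case: (ip y f) => a2 c2; case: (ip _ f) => a c /= -> ->.
by rewrite !(mul0r, mul1r, mulr0, mulN1r, oppr0, addr0, add0r, subr0, opprK) => -> ->.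
Qed.

(** Follows from the symmetry of [ip] on [F]. It shows both that [J] is well defined and that it
    reverses inner products. *)
Lemma real_form_ip_decomp x y x' y' : F x -> F y -> F x' -> F y' ->
  ip (x - 'i%C *: y) (x' - 'i%C *: y') = ip (x' + 'i%C *: y') (x + 'i%C *: y).
Proof.
move=> Fx Fy Fx' Fy'; rewrite !ipE conj_i.
rewrite (real_form_ip x' x) // (real_form_ip x' y) // (real_form_ip y' x) //.
by rewrite (real_form_ip y' y) //; ring.
Qed.

(** The difference of the right-hand equation has the same norm as that of the hypothesis, namely
    zero. *)
Lemma real_form_inj x y x' y' : F x -> F y -> F x' -> F y' ->
  x + 'i%C *: y = x' + 'i%C *: y' -> x - 'i%C *: y = x' - 'i%C *: y'.
Proof.
move=> Fx Fy Fx' Fy' e; apply/subr0_eq/ip_eq0.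
have -> : x - 'i%C *: y - (x' - 'i%C *: y') = (x - x') - 'i%C *: (y - y').
  by apply: ip_injl => z; rewrite !ipE; ring.
rewrite real_form_ip_decomp; try by apply: real_formD => //; apply: real_formN.
have -> : x - x' + 'i%C *: (y - y') = (x + 'i%C *: y) - (x' + 'i%C *: y').
  by apply: ip_injl => z; rewrite !ipE; ring.
by rewrite e subrr ip0l.
Qed.

Lemma real_form_conj : exists J : H -> H,
  forall x y, F x -> F y -> J (x + 'i%C *: y) = x - 'i%C *: y.
Proof.
have /choice[p hp] := real_form_decomp.
exists (fun h => (p h).1 - 'i%C *: (p h).2) => x y Fx Fy.
have [F1 F2 e] := hp (x + 'i%C *: y).
by apply: real_form_inj.
Qed.

End RealForm.

(** * Conjugations compatible with the bicommutant *)

Lemma sa_conjugation_exists v : exists J : H -> H,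
  [/\ J v = v, forall a x y, J (a *: x + y) = a^* *: J x + J y,
      forall x, J (J x) = x, forall x y, ip (J x) (J y) = ip y x
    & forall T, sa_bicommutant T -> forall x, J (T x) = T (J x)].
Proof.
have [F [Fv Frel Fmax]] := real_form_exists v.
have [J JE] := real_form_conj F Frel Fmax; have dec := real_form_decomp F Frel Fmax.
have FD := real_formD F Frel Fmax; have FZ := real_formZ F Frel Fmax.
have FN := real_formN F Frel Fmax; have F0 := real_form0 F Fmax.
exists J; split.
- by have := JE v 0 Fv F0; rewrite scaler0 subr0 addr0.
- move=> a x y; have [[x1 x2] /= [Fx1 Fx2 ->]] := dec x.
  have [[y1 y2] /= [Fy1 Fy2 ->]] := dec y; rewrite !JE // (complexE a).
  move: (complex.Re a) (complex.Im a) => r s.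
  (* Regroup the combination into its two components in [F], where [J] can be evaluated. *)
  have -> : (r%:C%C + 'i%C * s%:C%C) *: (x1 + 'i%C *: x2) + (y1 + 'i%C *: y2) =
     (r%:C%C *: x1 + - (s%:C%C *: x2) + y1) + 'i%C *: (r%:C%C *: x2 + s%:C%C *: x1 + y2).
    apply: ip_injl => z; rewrite !ipE.
    transitivity (r%:C%C * ip x1 z + ('i%C * 'i%C) * s%:C%C * ip x2 z + ip y1 z +
       'i%C * (r%:C%C * ip x2 z + s%:C%C * ip x1 z + ip y2 z)); first by ring.
    by rewrite mul_ii; ring.
  have F1 : F (r%:C%C *: x1 + - (s%:C%C *: x2) + y1).
    by apply/FD => //; apply/FD; [apply/FZ | apply/FN/FZ].
  have F2 : F (r%:C%C *: x2 + s%:C%C *: x1 + y2).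
    by apply/FD => //; apply/FD; apply/FZ.
  rewrite JE //.
  rewrite rmorphD rmorphM /= conj_i !conj_real.
  apply: ip_injl => z; rewrite !ipE.
  transitivity (r%:C%C * ip x1 z + ('i%C * 'i%C) * s%:C%C * ip x2 z + ip y1 z -
       'i%C * (r%:C%C * ip x2 z + s%:C%C * ip x1 z + ip y2 z)); last by ring.
  by rewrite mul_ii; ring.
- move=> x; have [[x1 x2] /= [Fx1 Fx2 ->]] := dec x; rewrite JE // -scalerN.
  by rewrite JE ?scalerN ?opprK //; apply: FN.
- move=> x y; have [[x1 x2] /= [Fx1 Fx2 ->]] := dec x.
  have [[y1 y2] /= [Fy1 Fy2 ->]] := dec y; rewrite !JE //.
  exact: real_form_ip_decomp Frel _ _ _ _ _ _ _ _.
(* [T] is complex linear and preserves [F], so it acts on the two components separately. *)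
- move=> T hT x; have [[x1 x2] /= [Fx1 Fx2 ->]] := dec x.
  have Tl := adjoint_linear _ _ hT.1; have inv := real_form_invariant F Frel Fmax T.
  have FT1 := inv x1 hT Fx1; have FT2 := inv x2 hT Fx2.
  rewrite (linear_opD T _ _ Tl) (linear_opZ T _ _ Tl) !JE // (linear_opD T _ _ Tl).
  by rewrite -!scaleNr (linear_opZ T _ _ Tl).
Qed.

(* The previous lemma applies to the real and imaginary parts of [T]. *)
Lemma bicommutant_conjugation_exists v : exists J : H -> H,
  [/\ J v = v, forall a x y, J (a *: x + y) = a^* *: J x + J y,
      forall x, J (J x) = x, forall x y, ip (J x) (J y) = ip y x
    & forall T Ts, is_adjoint ip T Ts -> bicommutant T ->
        forall x, J (T x) = Ts (J x)].
Proof.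
have [J [Jv Jl JJ Jip Jsa]] := sa_conjugation_exists v; exists J; split=> // T Ts TTs Tc x.
have Tsc := bicommutant_adjoint _ _ TTs Tc; have TsT := adjoint_sym _ _ TTs.
have cl S : commutant S -> is_linear_op S by case=> Ss [/adjoint_linear].
have hA : sa_bicommutant (fun x => T x + Ts x).
  split=> [y z|S Sc y]; first by rewrite !ipE TTs TsT addrC.
  by rewrite Tc // Tsc // linear_opD //; apply: cl.
have hB : sa_bicommutant (fun x => 'i%C *: (T x - Ts x)).
  split=> [y z|S Sc y]; first by rewrite !ipE TTs TsT conj_i; ring.
  have Sl := cl _ Sc.
  have SN w : S (- w) = - S w by rewrite -scaleN1r (linear_opZ S _ _ Sl) scaleN1r.
  by rewrite Tc // Tsc // (linear_opZ S _ _ Sl) (linear_opD S _ _ Sl) SN.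
have J0 : J 0 = 0.
  by have := Jl (-1) 0 0; rewrite scaler0 addr0 rmorphN1 scaleN1r addNr.
have JD y z : J (y + z) = J y + J z by have := Jl 1 y z; rewrite !scale1r rmorph1 scale1r.
have JZ a y : J (a *: y) = a^* *: J y by have := Jl a y 0; rewrite J0 !addr0.
(* [J] is conjugate-linear, so the factor ['i] flips a sign: [J] commutes with [T + Ts] and
   anticommutes with [T - Ts]. Adding the two relations gives twice the claim. *)
have /= e1 := Jsa _ hA x; have /= e2 := Jsa _ hB x; rewrite JD in e1.
move: e2; rewrite JZ conj_i JD -scaleN1r JZ rmorphN1 !scaleN1r scaleNr -scalerN.
have i0 : 'i%C != 0 :> R[i] by rewrite eq_complex /= oner_eq0 andbF.
move=> /(scalerI i0) e2.
have two : 2%:R != 0 :> R[i] by rewrite pnatr_eq0.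
apply: (scalerI two); rewrite !scaler_nat !mulr2n.
have -> : J (T x) + J (T x) = (J (T x) + J (Ts x)) - (- (J (T x) - J (Ts x))).
  by rewrite opprK addrACA subrr addr0.
by rewrite e1 e2 opprB (addrC (T _)) addrACA subrr addr0.
Qed.

End Bicommutant.
End SeparableHilbert.

(** * The conjugation [U J] and the perturbed operator *)

Theorem theorem4p1 (R : realType) (H : lmodType R[i]) (ip : H -> H -> R[i])
  (hH : is_sep_hilbert ip) (N U : H -> H) (a : R[i]) (v : H)
  (hN : normal_op ip N) (hU : unitary_op ip U) (hUW : in_Wstar ip N U) :
  complex_symmetric ip (fun x => N x + a *: rank_one ip (U v) v x).
Proof.
have [Nb [Ns [NNs NC]]] := hN; have [_ [Us [UUs [UUsK UsUK]]]] := hU.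
have [Ub Uc] : bounded_op ip U /\ bicommutant _ _ ip N Ns U.
  apply: (hUW (fun T => bounded_op ip T /\ bicommutant _ _ ip N Ns T)).
    exact: bicommutant_vN.
  by split=> // S [_ [_ [SN _]]] x.
have NN : bicommutant _ _ ip N Ns N by move=> S [_ [_ [SN _]]] x.
have [J [Jv Jl JJ Jip JT]] := bicommutant_conjugation_exists _ _ _ hH N Ns NNs NC v.
have JU := JT _ _ UUs Uc; have JN := JT _ _ NNs NN.
have JNs x : J (Ns x) = N (J x) by rewrite -{1}(JJ x) -JN JJ.
(* By normality [N] lies in the commutant, so [U] commutes with it. *)
have UN x : U (N x) = N (U x) by apply: Uc; exists Ns.
(* With [C = U J] one has [C v = U v], and [C] reverses inner products. *)
have Cv w : (ip (U (J w)) (U v))^* = ip w v.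
  by rewrite UUs UsUK -{1}Jv Jip (ip_conj _ _ _ hH).
exists (fun y => Ns y + a^* *: rank_one ip v (U v) y); split.
  move=> x y; rewrite /rank_one !(ipE _ _ _ hH) NNs conjCK (ip_conj _ _ _ hH).
  by ring.
exists (fun x => U (J x)); split; first split.
- by move=> c x y; rewrite Jl Ub.1.
- by move=> x; rewrite /hnorm UUs UsUK Jip.
(* Since [J U = Us J], the square of [U J] is [U Us J J], the identity. *)
- by move=> x; rewrite JU JJ UUsK.
(* The normal part becomes [U J Ns U J = U N J U J = U N Us = N]. In the rank-one part [J] turns
   [a^*] back into [a], [Cv] gives the coefficient [ip x v], and [v] is sent to [U v]. *)
- move=> x; rewrite /rank_one !scalerA [in RHS]addrC Jl Ub.1 Jv rmorphM /=.
  by rewrite conjCK Cv JNs JU JJ UN UUsK addrC.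
Qed.
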